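(* Let $n\geq 3$, let $W$ be a finite Coxeter group acting on $\mathbb{R}^n$, generated by the reflections $r_1,\dots,r_n$ in the hyperplanes orthogonal to its simple roots $\alpha_1,\dots,\alpha_n$, and let $P$ be the polytope generated by $W$ from a single seed point. Suppose that (i) the Coxeter-Dynkin diagram of $W$ forms a connected line with no branches or loops; and (ii) the seed decoration of the diagram has exactly one square $\square$, and it is placed at one of the two extreme nodes (end nodes) of the diagram. Then for every dimension $0\leq d\leq n-1$ the $d$-dimensional faces of $P$ form exactly one orbit under $W$, i.e. $P$ is Platonic.
   Context: Finite Coxeter group: a finite reflection group $W$ acting on the real Euclidean space $\mathbb{R}^n$ spanned by linearly independent simple roots $\alpha_1,\dots,\alpha_n$. It is either the Weyl group of a finite-dimensional simple Lie algebra or one of the non-crystallographic groups $H_2,H_3,H_4$. It is generated by the reflections $r_k x = x-\frac{2\langle \alpha_k,x\rangle}{\langle\alpha_k,\alpha_k\rangle}\alpha_k$, $k=1,\dots,n$. The Coxeter-Dynkin diagram has one node for each $r_k$. Two nodes are linked exactly when the corresponding simple roots are not orthogonal, and the links carry the usual marks (multiplicity or label) encoding relative angles and lengths. Polytope generated by $W$: the convex hull $P$ of the orbit $Wx_0$ of a single point $x_0\in\mathbb{R}^n$ (the seed point). The seed point is taken in the closed dominant chamber, i.e. $\langle\alpha_k,x_0\rangle\geq 0$ for all $k$. Faces are those of the convex polytope $P$. Seed decoration: node $k$ is decorated by $\square$ if $r_k$ moves the seed point ($r_kx_0\neq x_0$), and by $\lozenge$ if $r_k$ fixes it ($r_kx_0=x_0$).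 Thus exactly one square at node $k$ means that $x_0$ is a positive multiple of the fundamental weight $\omega_k$, i.e. $\langle \alpha_k,x_0\rangle>0$ and $\langle\alpha_j,x_0\rangle=0$ for $j\neq k$. Platonic: $P$ is called Platonic if, for each $0\leq d\leq n-1$, all $d$-dimensional faces of $P$ belong to a single orbit of $W$. *)

(* Defs.v *)
From HB Require Import structures.
From mathcomp Require Import all_boot all_order all_algebra all_fingroup.
From mathcomp Require Import boolp classical_sets functions cardinality reals convex.

Set Implicit Arguments.
Unset Strict Implicit.
Unset Printing Implicit Defensive.

Import Order.TTheory GRing.Theory Num.Theory.
Local Open Scope classical_set_scope.
Local Open Scope ring_scope.

Definition dot (R : realType) (n : nat) (u v : 'rV[R]_n) : R :=
  (u *m v^T) 0 0.

Definition refl (R : realType) (n : nat) (a x : 'rV[R]_n) : 'rV[R]_n :=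
  x - (2 * dot a x / dot a a) *: a.

(* The reflections are involutions, so the closure under composition is
   already closed under inverses. *)
Inductive coxeter_group (R : realType) (n : nat) (alpha : 'I_n -> 'rV[R]_n) :
    set ('rV[R]_n -> 'rV[R]_n) :=
| coxeter_group_id : coxeter_group alpha id
| coxeter_group_comp k w :
    coxeter_group alpha w -> coxeter_group alpha (refl (alpha k) \o w).

Definition roots (R : realType) (n : nat) (alpha : 'I_n -> 'rV[R]_n) :
    set 'rV[R]_n :=
  [set b | exists2 w, coxeter_group alpha w & exists k, b = w (alpha k)].

(* The last clause is what makes [alpha] a system of simple roots, and not just
   a basis whose reflections generate a finite group. The lengths of the simple
   roots are not normalized. *)
Definition finite_coxeter (R : realType) (n : nat)
    (alpha : 'I_n -> 'rV[R]_n) : Prop :=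
  [/\ row_free (\matrix_(k < n) alpha k),
      finite_set (coxeter_group alpha) &
      forall b, roots alpha b ->
        exists2 c : 'I_n -> R, b = \sum_k c k *: alpha k &
          (forall k, 0 <= c k) \/ (forall k, c k <= 0)].

Definition linked (R : realType) (n : nat) (alpha : 'I_n -> 'rV[R]_n) :
    rel 'I_n :=
  fun i j => (i != j) && (dot (alpha i) (alpha j) != 0).

(* The diagram is a path: [s] lists the nodes so that exactly the consecutive
   ones are linked. *)
Definition line_diagram (R : realType) (n : nat)
    (alpha : 'I_n -> 'rV[R]_n) : Prop :=
  exists s : {perm 'I_n}, forall i j : 'I_n,
    linked alpha (s i) (s j) = (i.+1 == j :> nat) || (j.+1 == i :> nat).

Definition end_node (R : realType) (n : nat) (alpha : 'I_n -> 'rV[R]_n)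
    (k : 'I_n) : Prop :=
  #|[set j | linked alpha k j]%SET| = 1%N.

Definition dominant (R : realType) (n : nat) (alpha : 'I_n -> 'rV[R]_n)
    (x : 'rV[R]_n) : Prop :=
  forall k, 0 <= dot (alpha k) x.

Definition square (R : realType) (n : nat) (alpha : 'I_n -> 'rV[R]_n)
    (x : 'rV[R]_n) (k : 'I_n) : Prop :=
  refl (alpha k) x <> x.

Definition conv_hull (R : realType) (n : nat) (A : set 'rV[R]_n) :
    set 'rV[R]_n :=
  smallest (@convex_set R 'rV[R]_n) A.

Definition polytope (R : realType) (n : nat) (alpha : 'I_n -> 'rV[R]_n)
    (x : 'rV[R]_n) : set 'rV[R]_n :=
  conv_hull [set w x | w in coxeter_group alpha].

(* Nonempty faces, cut out by valid linear inequalities. The polytope itself is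
   a face (for [c = 0]). *)
Definition is_face (R : realType) (n : nat) (P F : set 'rV[R]_n) : Prop :=
  F !=set0 /\
  exists c : 'rV[R]_n, exists2 b : R,
    (forall y, P y -> dot c y <= b) & F = P `&` [set y | dot c y = b].

(* [U] is the direction of the affine hull of [F]. *)
Definition has_dim (R : realType) (n : nat) (F : set 'rV[R]_n) (d : nat) :
    Prop :=
  F !=set0 /\
  exists U : {vspace 'rV[R]_n},
    [/\ \dim U = d,
        forall x y, F x -> F y -> x - y \in U &
        forall V : {vspace 'rV[R]_n},
          (forall x y, F x -> F y -> x - y \in V) -> (U <= V)%VS].

Definition faces (R : realType) (n : nat) (P : set 'rV[R]_n) (d : nat) :
    set (set 'rV[R]_n) :=
  [set F | is_face P F /\ has_dim F d].

(* For every [d < n] the [d]-faces are exactly one orbit, in particular there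
   is at least one of them. *)
Definition platonic (R : realType) (n : nat)
    (W : set ('rV[R]_n -> 'rV[R]_n)) (P : set 'rV[R]_n) : Prop :=
  forall d : nat, (d < n)%N ->
    exists F0 : set 'rV[R]_n, faces P d = [set w @` F0 | w in W].

(* Main.v *)
Require Import Defs.
From HB Require Import structures.
From mathcomp Require Import all_boot all_order all_algebra all_fingroup.
From mathcomp Require Import boolp classical_sets cardinality.
From mathcomp Require Import interval_inference reals convex lra ring zify.

(** A face of the polytope P is cut out by a linear form c, and applying an
    element of the group makes c dominant. Since the seed x is dominant too,
    every orbit point y satisfies x - y = sum of a_j alpha_j with all a_j >= 0
    ([dominant_ge_orbit]); hence a dominant c is maximal on P at x, and the
    vertices of the exposed face are those for which x - y only involves the
    simple roots orthogonal to c.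

    Number the nodes along the line, starting from the end that carries the
    square, and let m be the first position at which c is not orthogonal to the
    simple root. The nodes orthogonal to c are then 0, ..., m-1, together with
    some nodes lying beyond m. The latter are not linked to the former, and
    their reflections fix the seed; so they do not contribute, and x - y lies
    in the span of the first m simple roots ([orbit_exposed]). The exposed face
    is therefore P cut by x + span (alpha_0, ..., alpha_(m-1)), which depends
    on m only ([exposed_flag_face]). It is called the m-th flag face below: for
    varying m, these faces form a complete flag.

    The m-th flag face has dimension m ([has_dim_flag]): starting from x and
    reflecting in the nodes 0, 1, 2, ... in turn, the diagram being connected,
    each reflection moves the current vertex, by a nonzero multiple of the next
    simple root. So every face of dimension d is the image of the d-th flag
    face ([faces_orbit]).

    The inequality x - w x >= 0 rests on the exchange property ([exchange]):
    if w^-1 alpha_k is a negative root, then r_k w can be written with fewer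
    reflections than w. *)

Set Implicit Arguments.
Unset Strict Implicit.
Unset Printing Implicit Defensive.
Import Order.TTheory GRing.Theory Num.Theory.
Local Open Scope classical_set_scope.
Local Open Scope ring_scope.

(** * Dot product and reflections *)

Section DotProduct.
Variables (R : realType) (n : nat).
Implicit Types (u v w a x y : 'rV[R]_n) (t : R).

Lemma dotE u v : dot u v = \sum_i u 0 i * v 0 i.
Proof. by rewrite /dot mxE; apply: eq_bigr => i _; rewrite mxE. Qed.

Lemma dotC u v : dot u v = dot v u.
Proof. by rewrite !dotE; apply: eq_bigr => i _; rewrite mulrC. Qed.

Lemma dotDr u v w : dot u (v + w) = dot u v + dot u w.
Proof. by rewrite /dot linearD mulmxDr mxE. Qed.

Lemma dotZr t u v : dot u (t *: v) = t * dot u v.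
Proof. by rewrite /dot linearZ -scalemxAr mxE. Qed.

Lemma dotDl u v w : dot (v + w) u = dot v u + dot w u.
Proof. by rewrite dotC dotDr !(dotC u). Qed.

Lemma dotZl t u v : dot (t *: v) u = t * dot v u.
Proof. by rewrite dotC dotZr (dotC u). Qed.

Lemma dotBr u v w : dot u (v - w) = dot u v - dot u w.
Proof. by rewrite dotDr -scaleN1r dotZr mulN1r. Qed.

Lemma dotBl u v w : dot (v - w) u = dot v u - dot w u.
Proof. by rewrite dotC dotBr !(dotC u). Qed.

Lemma dot_sumr (I : Type) (r : seq I) (P : pred I) (F : I -> 'rV[R]_n) u :
  dot u (\sum_(i <- r | P i) F i) = \sum_(i <- r | P i) dot u (F i).
Proof.
elim/big_rec2: _ => [|i y x _ <-]; last by rewrite dotDr.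
by rewrite -(scale0r u) dotZr mul0r.
Qed.

Lemma dot_ge0 v : 0 <= dot v v.
Proof. by rewrite dotE sumr_ge0 // => i _; rewrite -expr2 sqr_ge0. Qed.

Lemma dot_le0 v : dot v v <= 0 -> v = 0.
Proof.
move=> h; have /eqP : dot v v = 0 by apply/eqP; rewrite eq_le h dot_ge0.
rewrite dotE psumr_eq0; last by move=> i _; rewrite -expr2 sqr_ge0.
move/allP => /= v0; apply/rowP => i; rewrite mxE.
by have := v0 i (mem_index_enum i); rewrite mulf_eq0 orbb => /eqP.
Qed.

Lemma dot_gt0 v : v != 0 -> 0 < dot v v.
Proof. by move=> v0; rewrite ltNge; apply: contra v0 => /dot_le0 ->. Qed.

Lemma dot_reflr c a x :
  dot c (refl a x) = dot c x - 2 * dot a x / dot a a * dot c a.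
Proof. by rewrite /refl dotBr dotZr. Qed.

Lemma refl_linear a t x y : refl a (t *: x + y) = t *: refl a x + refl a y.
Proof.
rewrite /refl dotDr dotZr scalerBr scalerA addrACA -opprD -scalerDl.
by congr (_ - _ *: _); ring.
Qed.

Lemma refl0 x : refl 0 x = x.
Proof. by rewrite /refl scaler0 subr0. Qed.

(** This holds for a = 0 as well, because division by zero yields zero and
    [refl 0] is then the identity; the same goes for [reflK]. *)
Lemma dot_refl a x y : dot (refl a x) (refl a y) = dot x y.
Proof.
have [->|/dot_gt0 a0] := eqVneq a 0; first by rewrite !refl0.
rewrite /refl !(dotBl, dotBr, dotZl, dotZr) (dotC x a).
by field; rewrite gt_eqF.
Qed.

Lemma reflK a : involutive (refl a).
Proof.
move=> x; have [->|/dot_gt0 a0] := eqVneq a 0; first by rewrite !refl0.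
rewrite {1}/refl dot_reflr /refl -addrA -opprD -scalerDl.
set t := (X in X *: a); suff -> : t = 0 by rewrite scale0r subr0.
by rewrite /t; field; rewrite gt_eqF.
Qed.

Lemma refl_scale t a x : t != 0 -> refl (t *: a) x = refl a x.
Proof.
move=> t0; have [->|/dot_gt0 a0] := eqVneq a 0; first by rewrite scaler0.
rewrite /refl !dotZl dotZr scalerA; congr (_ - _ *: _).
by field; rewrite t0 gt_eqF.
Qed.

Lemma refl_id a x : a != 0 -> refl a x = x -> dot a x = 0.
Proof.
move=> a0 /eqP; rewrite /refl subr_eq addrC -subr_eq subrr eq_sym.
rewrite scaler_eq0 (negPf a0) orbF !mulf_eq0 invr_eq0 (gt_eqF (dot_gt0 a0)).
by rewrite orbF pnatr_eq0 => /eqP.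
Qed.

End DotProduct.

(** * Maxima, convex hulls and dimensions *)

Lemma finite_set_argmax (R : realType) (T : Type) (A : set T) (f : T -> R) :
  finite_set A -> A !=set0 ->
  exists2 a, A a & forall b, A b -> f b <= f a.
Proof.
move=> finA [a0 Aa0].
have /finite_seqP[s sE] := finite_image f finA.
have memP a : A a -> f a \in s.
  by move=> Aa; have : [set` s] (f a) by rewrite -sE; exists a.
pose M := \big[Order.max/f a0]_(z <- s) z.
have [a Aa fa] : (f @` A) M.
  rewrite /M; have : forall z, z \in s -> (f @` A) z by move=> z; rewrite sE.
  elim: s {sE memP M} => [|z s IH] sA; first by rewrite big_nil; exists a0.
  rewrite big_cons; case: leP => _; last by apply: sA; rewrite mem_head.
  by apply: IH => y ys; apply: sA; rewrite inE ys orbT.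
exists a => // b /memP; rewrite fa /M => {M sE memP fa}.
elim: s => // z s IH; rewrite inE big_cons le_max => /orP[/eqP->|/IH ->].
  by rewrite lexx.
by rewrite orbT.
Qed.

Section ConvexHull.
Variables (R : realType) (n : nat).
Implicit Types (A Q : set 'rV[R]_n).

Lemma convex_setE Q : @convex_set R 'rV[R]_n Q <->
  (forall x y t, Q x -> Q y -> 0 <= t <= 1 -> Q (t *: x + (1 - t) *: y)).
Proof.
split=> [cQ x y t Qx Qy /andP[t0 t1]|cQ x y t].
  by have := cQ x y (Itv01 t0 t1); rewrite !inE => /(_ Qx Qy).
rewrite !inE => Qx Qy; apply: cQ => //.
by apply/andP; split; [exact: ge0|exact: le1].
Qed.

Lemma conv_hull_convex A x y t :
  conv_hull A x -> conv_hull A y -> 0 <= t <= 1 ->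
  conv_hull A (t *: x + (1 - t) *: y).
Proof.
move=> Ax Ay t01 Q [cQ AQ]; move/convex_setE: (cQ); apply=> //.
- exact: Ax.
- exact: Ay.
Qed.

Lemma conv_hull_sub A Q :
  (forall x y t, Q x -> Q y -> 0 <= t <= 1 -> Q (t *: x + (1 - t) *: y)) ->
  A `<=` Q -> conv_hull A `<=` Q.
Proof. by move=> /convex_setE cQ AQ; apply: smallest_sub. Qed.

End ConvexHull.

Section Dimension.
Variables (R : realType) (n : nat).
Implicit Types (F : set 'rV[R]_n).

Lemma has_dim_uniq F d d' : has_dim F d -> has_dim F d' -> d = d'.
Proof.
move=> [_ [U [<- FU minU]]] [_ [U' [<- FU' minU']]].
by congr (\dim _); apply/eqP; rewrite eqEsubv minU // minU'.
Qed.

(** The linear map is injective, so the image of the direction space keeps its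
    dimension; its minimality is that of U tested against preimages. *)
Lemma has_dim_image (f g : 'rV[R]_n -> 'rV[R]_n) F d :
  linear f -> cancel f g -> has_dim F d -> has_dim (f @` F) d.
Proof.
move=> lf fK [[x Fx] [U [dU FU minU]]]; split; first by exists (f x), x.
pose fL := GRing.isLinear.Build R _ _ _ f lf.
pose h : {linear 'rV[R]_n -> 'rV[R]_n} := HB.pack f fL.
have hE y : linfun h y = f y by rewrite lfunE.
have ker0 : lker (linfun h) == 0%VS.
  by apply/lker0P => y z; rewrite !hE => /(can_inj fK).
have fB y z : f y - f z = linfun h (y - z) by rewrite -!hE raddfB.
exists (linfun h @: U)%VS; split.
- by rewrite limg_dim_eq // (eqP ker0) capv0.
- by move=> _ _ [y Fy <-] [z Fz <-]; rewrite fB memv_img // FU.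
- move=> V VP; apply: (@subv_trans _ _ (linfun h @: (linfun h @^-1: V))%VS).
    rewrite limgS // minU // => y z Fy Fz.
    by rewrite -memv_preim -fB; apply: VP; [exists y|exists z].
  by apply/subvP => _ /memv_imgP[y + ->]; rewrite -memv_preim.
Qed.

End Dimension.

(** * Coordinates with respect to the simple roots *)

Section SimpleRootCoordinates.
Variables (R : realType) (n : nat) (alpha : 'I_n -> 'rV[R]_n).

Definition coef (v : 'rV[R]_n) (k : 'I_n) : R :=
  (v *m invmx (\matrix_j alpha j)) 0 k.

Lemma coefD u v k : coef (u + v) k = coef u k + coef v k.
Proof. by rewrite /coef mulmxDl mxE. Qed.

Lemma coefZ t v k : coef (t *: v) k = t * coef v k.
Proof. by rewrite /coef -scalemxAl mxE. Qed.

Lemma coef0 k : coef 0 k = 0.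
Proof. by rewrite /coef mul0mx mxE. Qed.

Lemma coefB u v k : coef (u - v) k = coef u k - coef v k.
Proof. by rewrite coefD -scaleN1r coefZ mulN1r. Qed.

Lemma coef_sum (I : finType) (P : pred I) (F : I -> 'rV[R]_n) k :
  coef (\sum_(i | P i) F i) k = \sum_(i | P i) coef (F i) k.
Proof. by rewrite /coef mulmx_suml summxE. Qed.

Hypothesis alpha_free : row_free (\matrix_k alpha k).

Lemma alpha_unitmx : \matrix_k alpha k \in unitmx.
Proof. by rewrite -row_free_unit. Qed.

Lemma coefE v : v = \sum_k coef v k *: alpha k.
Proof.
rewrite -{1}(mulmxKV alpha_unitmx v) mulmx_sum_row.
by apply: eq_bigr => k _; rewrite rowK.
Qed.

Lemma coef_alpha j k : coef (alpha j) k = (j == k)%:R.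
Proof.
have -> : alpha j = row j (\matrix_k alpha k) by rewrite rowK.
by rewrite /coef -row_mul mulmxV ?alpha_unitmx // row1 mxE eqxx eq_sym.
Qed.

Lemma alpha_neq0 k : alpha k != 0.
Proof.
apply/eqP => a0; have := coef_alpha k k.
by rewrite a0 coef0 eqxx => /esym/eqP; rewrite oner_eq0.
Qed.

Lemma alpha_gt0 k : 0 < dot (alpha k) (alpha k).
Proof. exact/dot_gt0/alpha_neq0. Qed.

Lemma coef_refl k x j :
  coef (refl (alpha k) x) j =
  coef x j - 2 * dot (alpha k) x / dot (alpha k) (alpha k) * (k == j)%:R.
Proof. by rewrite coefB coefZ coef_alpha. Qed.

Lemma coef_sub_refl k x y j :
  coef (x - refl (alpha k) y) j =
  coef (x - y) j + 2 * dot (alpha k) y / dot (alpha k) (alpha k) * (k == j)%:R.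
Proof. by rewrite coefB coef_refl coefB opprB addrCA addrC. Qed.

Lemma dot_coef c v : dot c v = \sum_k coef v k * dot c (alpha k).
Proof.
by rewrite {1}(coefE v) dot_sumr; apply: eq_bigr => k _; rewrite dotZr.
Qed.

Lemma coef_eq0 v : (forall k, coef v k = 0) -> v = 0.
Proof. by move=> v0; rewrite (coefE v) big1 // => k _; rewrite v0 scale0r. Qed.

(** The simple roots form a basis, so any values can be prescribed; this
    provides sums of fundamental coweights. *)
Lemma prescribed_dots (b : 'I_n -> R) :
  exists c, forall k, dot (alpha k) c = b k.
Proof.
exists (invmx (\matrix_k alpha k) *m \col_k b k)^T => k.
rewrite /dot trmxK mulmxA.
have {1}-> : alpha k = row k (\matrix_k alpha k) by rewrite rowK.
by rewrite -!row_mul mulmxV ?alpha_unitmx // mul1mx !mxE.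
Qed.

End SimpleRootCoordinates.

(** * Words in the simple reflections *)

Section Words.
Variables (R : realType) (n : nat) (alpha : 'I_n -> 'rV[R]_n).
Implicit Types (s t : seq 'I_n) (x y : 'rV[R]_n).

(** Words are used in place of group elements so that induction on their size
    replaces the length function. *)
Definition act s x : 'rV[R]_n := foldr (fun k => refl (alpha k)) x s.

Lemma act_cons k s x : act (k :: s) x = refl (alpha k) (act s x).
Proof. by []. Qed.

Lemma act_cat s t x : act (s ++ t) x = act s (act t x).
Proof. exact: foldr_cat. Qed.

Lemma act_rcons s k x : act (rcons s k) x = act s (refl (alpha k) x).
Proof. by rewrite -cats1 act_cat. Qed.

Lemma act_linear s : linear (act s).
Proof. by elim: s => // k s IH a x y; rewrite !act_cons IH refl_linear. Qed.

Lemma actB s x y : act s (x - y) = act s x - act s y.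
Proof. by rewrite addrC -scaleN1r act_linear scaleN1r addrC. Qed.

Lemma act0 s : act s 0 = 0.
Proof. by rewrite -[RHS](subrr (act s 0)) -actB subrr. Qed.

Lemma actZ s a x : act s (a *: x) = a *: act s x.
Proof. by rewrite -[a *: x]addr0 act_linear act0 addr0. Qed.

Lemma dot_act s x y : dot (act s x) (act s y) = dot x y.
Proof. by elim: s => // k s IH; rewrite !act_cons dot_refl. Qed.

Lemma actK s : cancel (act s) (act (rev s)).
Proof.
by elim: s => // k s IH x; rewrite rev_cons act_rcons reflK IH.
Qed.

Lemma actVK s : cancel (act (rev s)) (act s).
Proof. by move=> x; rewrite -{1}(revK s) actK. Qed.

Lemma dot_act_rev s x y : dot (act s x) y = dot x (act (rev s) y).
Proof. by rewrite -{1}(actVK s y) dot_act. Qed.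

Lemma refl_act s b y : refl (act s b) (act s y) = act s (refl b y).
Proof. by rewrite /refl actB actZ !dot_act. Qed.

Lemma coxeter_groupP w :
  coxeter_group alpha w <-> exists s, w = act s.
Proof.
split=> [|[s ->]]; last by elim: s => [|k s IH]; constructor.
by elim=> [|k _ _ [s ->]]; [exists [::]|exists (k :: s)].
Qed.

End Words.

(** * The exchange property and dominant vectors *)

Section Dominance.
Variables (R : realType) (n : nat) (alpha : 'I_n -> 'rV[R]_n).
Hypothesis hW : finite_coxeter alpha.
Implicit Types (s t : seq 'I_n) (x y c : 'rV[R]_n).

Local Notation act := (act alpha).
Local Notation coef := (coef alpha).

Lemma finite_coxeter_free : row_free (\matrix_k alpha k).
Proof. by case: hW. Qed.
Let alpha_free := finite_coxeter_free.

Lemma root_sign s k :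
  (forall j, 0 <= coef (act s (alpha k)) j) \/
  (forall j, coef (act s (alpha k)) j <= 0).
Proof.
case: hW => _ _ /(_ (act s (alpha k)))[].
  by exists (act s); [apply/coxeter_groupP; exists s|exists k].
move=> a aE.
have cE j : coef (act s (alpha k)) j = a j.
  rewrite aE coef_sum (bigD1 j) //= big1 ?addr0 => [|i /negPf ij];
    by rewrite coefZ coef_alpha // ?eqxx ?mulr1 // ij mulr0.
by case=> a_sign; [left|right] => j; rewrite cE.
Qed.

(** Write s = t i and let b be w_t^-1 alpha_k, which may be assumed positive by
    induction. The reflection r_i changes only the i-th coordinate of b, so if
    r_i b is negative, b is a multiple of alpha_i. Then r_k w_t = w_t r_i, and
    the last letter of s cancels in r_k w_s. *)
Lemma exchange s k :
  (forall j, 0 <= coef (act (rev s) (alpha k)) j) \/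
  exists2 s', (size s' < size s)%N &
    forall x, refl (alpha k) (act s x) = act s' x.
Proof.
elim/last_ind: s k => [|s i IH] k.
  by left=> j; rewrite coef_alpha // ler0n.
have [pos|[s' lt_s' s'E]] := IH k; last first.
  right; exists (rcons s' i); rewrite ?size_rcons // => x.
  by rewrite !act_rcons s'E.
case: (root_sign (rev (rcons s i)) k) => [|neg]; first by left.
right; exists s; rewrite ?size_rcons // => x; rewrite act_rcons.
set b := act (rev s) (alpha k) in pos *.
have bE : b = coef b i *: alpha i.
  apply/eqP; rewrite -subr_eq0; apply/eqP/(coef_eq0 alpha_free) => j.
  rewrite coefB coefZ coef_alpha //; have [<-|ij] := eqVneq i j.
    by rewrite mulr1 subrr.
  apply/eqP; rewrite mulr0 subr0 eq_le pos andbT.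
  have := neg j; rewrite rev_rcons act_cons -/b coef_refl //.
  by rewrite (negPf ij) mulr0 subr0.
have c0 : coef b i != 0.
  apply: contra_neq (alpha_neq0 alpha_free k) => c0.
  rewrite -(actVK alpha s (alpha k)) -/b bE c0.
  by rewrite scale0r act0.
by rewrite -{1}(actVK alpha s (alpha k)) refl_act -/b bE refl_scale // reflK.
Qed.

(** Prepending k to a word that [exchange] cannot shorten moves w x by
    -2 (alpha_k, w x) / (alpha_k, alpha_k) times alpha_k, and (alpha_k, w x) =
    (w^-1 alpha_k, x) is nonnegative because w^-1 alpha_k is a positive root. *)
Lemma dominant_ge_orbit x s : dominant alpha x ->
  forall j, 0 <= coef (x - act s x) j.
Proof.
move=> domx; have [m] := ubnP (size s); elim: m s => // m IH [|k s] sm j.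
  by rewrite subrr coef0.
rewrite act_cons; have [pos|[s' lt_s' ->]] := exchange s k; last first.
  by apply: IH; apply: leq_trans lt_s' (ltnW _).
rewrite coef_sub_refl // addr_ge0 ?IH //.
rewrite mulr_ge0 ?ler0n // divr_ge0 ?(ltW (alpha_gt0 alpha_free _)) //.
rewrite mulr_ge0 ?ler0n // dotC dot_act_rev (dot_coef alpha_free).
by apply: sumr_ge0 => i _; rewrite mulr_ge0 // dotC.
Qed.

Lemma orbit_argmax (Q : 'rV[R]_n -> Prop) x c s : Q (act s x) ->
  exists2 t, Q (act t x) &
    forall t', Q (act t' x) -> dot c (act t' x) <= dot c (act t x).
Proof.
case: hW => _ finW _ Qs.
pose B := [set w | coxeter_group alpha w /\ Q (w x)].
have finB : finite_set B by apply: sub_finite_set finW => w [].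
have B0 : B !=set0.
  by exists (act s); split=> //; apply/coxeter_groupP; exists s.
have [w [/coxeter_groupP[t ->] Qt] max_t] :=
  finite_set_argmax (fun w => dot c (w x)) finB B0.
exists t => // t' Qt'; apply: (max_t (act t')).
by split=> //; apply/coxeter_groupP; exists t'.
Qed.

(** A reflection that does not raise the height rho cannot be reflecting out of
    the negative side of its mirror. *)
Lemma refl_ge k rho y : 0 < dot (alpha k) rho ->
  dot rho (refl (alpha k) y) <= dot rho y -> 0 <= dot (alpha k) y.
Proof.
move=> rk; rewrite dot_reflr gerBl (dotC rho) pmulr_lge0 //.
by rewrite pmulr_lge0 ?invr_gt0 ?alpha_gt0 // pmulr_rge0.
Qed.

(** A point of maximal height in the orbit is dominant. *)
Lemma dominant_in_orbit x : exists s, dominant alpha (act s x).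
Proof.
have [rho rhoE] := prescribed_dots alpha_free (fun=> 1).
have [s _ max_s] := @orbit_argmax (fun=> True) x rho [::] I.
exists s => k; apply: (@refl_ge k rho); first by rewrite rhoE.
exact: (max_s (k :: s)).
Qed.

End Dominance.

(** * The action on the faces of the polytope *)

Section Polytope.
Variables (R : realType) (n : nat) (alpha : 'I_n -> 'rV[R]_n).
Variable x : 'rV[R]_n.
Implicit Types (s : seq 'I_n) (c y : 'rV[R]_n).

Local Notation act := (act alpha).
Local Notation P := (polytope alpha x).

Lemma orbit_polytope s : P (act s x).
Proof.
apply: sub_gen_smallest; exists (act s) => //.
by apply/coxeter_groupP; exists s.
Qed.

Lemma seed_polytope : P x.
Proof. exact: (orbit_polytope [::]). Qed.

Lemma polytope_ind (Q : 'rV[R]_n -> Prop) :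
  (forall y z a, Q y -> Q z -> 0 <= a <= 1 -> Q (a *: y + (1 - a) *: z)) ->
  (forall s, Q (act s x)) -> forall y, P y -> Q y.
Proof.
move=> cQ Qorb y; apply: (@conv_hull_sub _ _ _ Q cQ) => _ [w + <-].
by move=> /coxeter_groupP[s ->].
Qed.

Lemma act_polytope s y : P y -> P (act s y).
Proof.
apply: (@polytope_ind (fun y => P (act s y))) => [u v a Pu Pv a01|t].
  by rewrite act_linear actZ; apply: conv_hull_convex.
by rewrite -act_cat; apply: orbit_polytope.
Qed.

Lemma act_supporting_section s c b :
  act s @` (P `&` [set y | dot c y = b]) =
  P `&` [set y | dot (act s c) y = b].
Proof.
apply/seteqP; split=> [_ [y [Py cy] <-]|y [Py cy]] /=.
  by split; [exact: act_polytope|rewrite dot_act].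
exists (act (rev s) y); last exact: actVK.
by split; [exact: act_polytope|rewrite /= -dot_act_rev].
Qed.

Lemma act_face s F : is_face P F -> is_face P (act s @` F).
Proof.
case=> -[y Fy] [c [b cP FE]]; split.
  by exists (act s y), y.
exists (act s c), b; last by rewrite FE act_supporting_section.
by move=> z Pz; rewrite dot_act_rev cP //; apply: act_polytope.
Qed.

Lemma act_faces s d F : faces P d F -> faces P d (act s @` F).
Proof.
move=> [faceF dimF]; split; first exact: act_face.
exact: has_dim_image (@act_linear _ _ _ s) (actK alpha s) dimF.
Qed.

End Polytope.

(** * Flag faces for a seed at the end of a line *)

Section LineDiagram.
Variables (R : realType) (n : nat) (alpha : 'I_n -> 'rV[R]_n).
Hypothesis hW : finite_coxeter alpha.
Variables (x : 'rV[R]_n) (pos : 'I_n -> 'I_n).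
Hypothesis domx : dominant alpha x.
Hypothesis pos_inj : injective pos.
Hypothesis linkedE : forall i j,
  linked alpha i j = ((pos i).+1 == pos j) || ((pos j).+1 == pos i).
Hypothesis seedE : forall j, (dot (alpha j) x != 0) = (pos j == 0%N :> nat).
Implicit Types (s : seq 'I_n) (c y z : 'rV[R]_n) (m : nat).

Local Notation act := (act alpha).
Local Notation coef := (coef alpha).
Local Notation P := (polytope alpha x).
Let alpha_free := finite_coxeter_free hW.

Definition flag_face m : set 'rV[R]_n :=
  P `&` [set y | forall j, (m <= pos j)%N -> coef (x - y) j = 0].

(** The largest initial segment of the line on which c is orthogonal to the
    simple roots consists of the positions below m. The case m = n, with no
    node at position m, is c = 0. *)
Definition first_nonzero c m : Prop :=
  (forall j, (pos j < m)%N -> dot (alpha j) c = 0) /\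
  (forall j, pos j = m :> nat -> dot (alpha j) c != 0).

Lemma dot_far i j : ((pos i).+1 < pos j)%N -> dot (alpha i) (alpha j) = 0.
Proof.
move=> ij; have ne : i != j.
  by apply: contraTneq ij => ->; rewrite -leqNgt leqnSn.
have := linkedE i j; rewrite /linked ne (ltn_eqF ij) /=.
rewrite gtn_eqF; first by move/negbFE/eqP.
by rewrite ltnS; apply: leq_trans (ltnW (ltnW ij)) _.
Qed.

Lemma dot_near i j : (pos i).+1 = pos j -> dot (alpha i) (alpha j) != 0.
Proof. by move=> ij; have := linkedE i j; rewrite ij eqxx => /andP[]. Qed.

(** If the conclusion fails, take y of maximal height among the orbit points on
    the hyperplane that violate it. If y lies on the nonnegative side of the
    mirrors of all simple roots orthogonal to c, then comparing norms gives
    y = x. If instead r_j y is higher, for some alpha_j orthogonal to c, then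
    r_j y satisfies the conclusion. For j before position m, so does y. For j
    beyond m, alpha_j is orthogonal to x and to the first m simple roots, hence
    to r_j y, so that r_j y = y after all. *)
Lemma orbit_exposed c m s : dominant alpha c -> first_nonzero c m ->
  dot c (act s x) = dot c x ->
  forall j, (m <= pos j)%N -> coef (x - act s x) j = 0.
Proof.
move=> domc [c0 cm].
pose span y := forall j, (m <= pos j)%N -> coef (x - y) j = 0.
move=> cs; case: (EM (span (act s x))) => // nspan.
have [rho rhoE] := prescribed_dots alpha_free (fun=> 1).
have [t [ct nt] max_t] :=
  @orbit_argmax _ _ _ hW (fun y => dot c y = dot c x /\ ~ span y) x rho s
    (conj cs nspan).
case: nt; set y := act t x in ct *.
have coef_ge0 j : 0 <= coef (x - y) j by exact: dominant_ge_orbit.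
(* (c, x - y) = 0 is a sum of nonnegative terms, so each one vanishes *)
have supp j : dot (alpha j) c != 0 -> coef (x - y) j = 0.
  move=> cj; have /eqP : dot c (x - y) = 0 by rewrite dotBr ct subrr.
  rewrite (dot_coef alpha_free) psumr_eq0 => [/allP v0|i _].
    have := v0 j (mem_index_enum j).
    by rewrite /= mulf_eq0 (dotC c) (negPf cj) orbF => /eqP.
  by rewrite mulr_ge0 // dotC.
case: (EM (forall j, dot (alpha j) c = 0 -> 0 <= dot (alpha j) y)) => [up|].
  suff xy : x - y = 0 by move=> j _; rewrite xy coef0.
  apply: dot_le0; have yy : dot y y = dot x x by rewrite dot_act.
  have -> : dot (x - y) (x - y) = - 2 * dot y (x - y).
    by rewrite !(dotBl, dotBr) yy (dotC y x); ring.
  rewrite mulNr oppr_le0 mulr_ge0 // (dot_coef alpha_free) sumr_ge0 // => j _.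
  have [cj|/supp ->] := eqVneq (dot (alpha j) c) 0; last by rewrite mul0r.
  by rewrite mulr_ge0 // dotC up.
move=> /existsNP[j /not_implyP[cj /negP]]; rewrite -ltNge => yj.
have cr : dot c (refl (alpha j) y) = dot c x.
  by rewrite dot_reflr (dotC c (alpha j)) cj mulr0 subr0.
have spanr : span (refl (alpha j) y).
  case: (EM (span (refl (alpha j) y))) => // nr; move: yj; rewrite ltNge.
  rewrite (@refl_ge _ _ _ hW j rho) ?rhoE //.
  by apply: (max_t (j :: t)).
have [jm|mj] := ltnP (pos j) m => i mi.
  have := spanr i mi; rewrite coef_sub_refl //.
  have /negPf-> : j != i by apply: contraTneq jm => ->; rewrite -leqNgt.
  by rewrite mulr0 addr0.
suff y0 : dot (alpha j) y = 0 by rewrite y0 ltxx in yj.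
have {}mj : (m < pos j)%N.
  by rewrite ltn_neqAle mj andbT; apply: contra_eq_neq cj => /esym/cm.
have : dot (alpha j) (refl (alpha j) y) = 0.
  rewrite -(subKr x (refl _ y)) dotBr [dot _ (x - _)](dot_coef alpha_free).
  rewrite big1 => [|k _].
    rewrite subr0; apply/eqP; rewrite -[_ == _]negbK seedE.
    by rewrite -lt0n (leq_trans _ mj).
  have [km|mk] := ltnP (pos k) m; last by rewrite spanr ?mul0r.
  by rewrite dotC dot_far ?mulr0 // (leq_ltn_trans km).
rewrite dot_reflr divfK ?(gt_eqF (alpha_gt0 alpha_free _)) //; lra.
Qed.

(** Both conclusions together, and not the second one alone, are stable under
    convex combinations: at a proper combination equality forces equality at
    both ends. This avoids writing points of P as finite combinations. *)
Lemma polytope_exposed c m y : dominant alpha c -> first_nonzero c m -> P y ->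
  dot c y <= dot c x /\ (dot c y = dot c x ->
  forall j, (m <= pos j)%N -> coef (x - y) j = 0).
Proof.
move=> domc cm; move: y; apply: polytope_ind => [y z a [cy fy] [cz fz]|s].
  move=> /andP[a0 a1]; rewrite dotDr !dotZr; split; first by nra.
  move=> cyz j mj.
  have -> : x - (a *: y + (1 - a) *: z) = a *: (x - y) + (1 - a) *: (x - z).
    by rewrite !scalerBr addrACA -opprD -scalerDl (addrC a) subrK scale1r.
  rewrite coefD !coefZ.
  have [a_eq0|a_neq0] := eqVneq a 0.
    by rewrite a_eq0 in cyz *; rewrite fz ?mulr0 ?mul0r ?addr0 //; lra.
  have [a_eq1|a_neq1] := eqVneq a 1.
    by rewrite a_eq1 in cyz *; rewrite fy ?mulr0 ?subrr ?mul0r ?addr0 //; lra.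
  have {}a0 : 0 < a by rewrite lt_def a_neq0.
  have {}a1 : a < 1 by rewrite lt_neqAle a_neq1.
  by rewrite fy ?fz ?mulr0 ?addr0 //; nra.
split; last exact: orbit_exposed.
rewrite -subr_ge0 -dotBr (dot_coef alpha_free) sumr_ge0 // => j _.
by rewrite mulr_ge0 ?(dominant_ge_orbit hW) // dotC.
Qed.

Lemma exposed_flag_face c m b : dominant alpha c -> first_nonzero c m ->
  (forall y, P y -> dot c y <= b) -> P `&` [set y | dot c y = b] !=set0 ->
  P `&` [set y | dot c y = b] = flag_face m.
Proof.
move=> domc cm cP [z [Pz /= cz]].
have <- : dot c x = b.
  apply/le_anti; rewrite cP /=; last exact: seed_polytope.
  rewrite -cz.
  by have [] := polytope_exposed domc cm Pz.
apply/seteqP; split=> y [Py /= fy]; split=> //=.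
  by have [_] := polytope_exposed domc cm Py; apply.
apply/eqP; rewrite eq_sym -subr_eq0 -dotBr (dot_coef alpha_free) big1 // => j _.
have [jm|mj] := ltnP (pos j) m; last by rewrite fy ?mul0r.
by rewrite dotC (proj1 cm) ?mulr0.
Qed.

Lemma flag_face_exposed m :
  exists c b, (forall y, P y -> dot c y <= b) /\
    flag_face m = P `&` [set y | dot c y = b].
Proof.
have [c cE] := prescribed_dots alpha_free (fun j => (m <= pos j)%N%:R).
have domc : dominant alpha c by move=> j; rewrite cE ler0n.
have cm : first_nonzero c m.
  split=> j jm; rewrite cE; first by rewrite leqNgt jm.
  by rewrite jm leqnn oner_neq0.
have cP y : P y -> dot c y <= dot c x.
  by move=> Py; have [] := polytope_exposed domc cm Py.
exists c, (dot c x); split=> //; apply/esym/exposed_flag_face => //.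
by exists x; split=> //; apply: seed_polytope.
Qed.

Lemma is_face_flag m : is_face P (flag_face m).
Proof.
split; last by have [c [b [cP fE]]] := flag_face_exposed m; exists c, b.
exists x; split; first exact: seed_polytope.
by move=> j _; rewrite subrr coef0.
Qed.

(** Connectedness enters here. Only the node just before i contributes to
    (alpha_i, x - z), and it is linked to i; when i is the first node, z = x and
    the square moves the seed. *)
Lemma next_moves i z :
  (forall j, (coef (x - z) j != 0) = (pos j < pos i)%N) ->
  dot (alpha i) z != 0.
Proof.
move=> zE; rewrite -(subKr x z) dotBr [dot _ (x - _)](dot_coef alpha_free).
have coef_hi j : (pos i <= pos j)%N -> coef (x - z) j = 0.
  by move=> ij; apply/eqP; rewrite -[_ == _]negbK zE -leqNgt.
have [i0|i_neq0] := eqVneq (pos i : nat) 0%N.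
  by rewrite big1 ?subr0 ?seedE ?i0 // => j _; rewrite coef_hi ?mul0r // i0.
have i1n : ((pos i).-1 < n)%N by apply: leq_ltn_trans (leq_pred _) (ltn_ord _).
pose j := invF pos_inj (Ordinal i1n).
have jE : pos j = (pos i).-1 :> nat by rewrite /j f_invF.
have ji : (pos j).+1 = pos i by rewrite jE prednK // lt0n.
rewrite (bigD1 j) //= big1 => [|k kj].
  have /eqP -> : dot (alpha i) x == 0 by rewrite -[_ == _]negbK seedE.
  rewrite addr0 sub0r oppr_eq0 mulf_neq0 ?zE ?ji //.
  by rewrite dotC dot_near.
have [ki|ik] := ltnP (pos k) (pos i); last by rewrite coef_hi ?mul0r.
rewrite dotC dot_far ?mulr0 // ltn_neqAle ki andbT -ji eqSS.
by apply: contra_neq kj => kj; apply: pos_inj; apply: val_inj.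
Qed.

Lemma descending_vertex m : (m <= n)%N ->
  exists s, forall j, (coef (x - act s x) j != 0) = (pos j < m)%N.
Proof.
elim: m => [_|m IH mn].
  by exists [::] => j; rewrite subrr coef0 eqxx.
have [s sE] := IH (ltnW mn); pose i := invF pos_inj (Ordinal mn).
have iE : pos i = m :> nat by rewrite /i f_invF.
exists (i :: s) => j; rewrite act_cons coef_sub_refl // ltnS leq_eqVlt -sE.
have [ij|ij] := eqVneq i j; last first.
  rewrite mulr0 addr0; suff /negPf -> : (pos j : nat) != m by [].
  by apply: contra_neq ij => jm; apply/pos_inj/val_inj; rewrite /= iE jm.
rewrite -ij iE eqxx /= mulr1.
have -> : coef (x - act s x) i = 0.
  by apply/eqP; rewrite -[_ == _]negbK sE iE ltnn.
rewrite add0r !mulf_neq0 ?pnatr_eq0 // ?invr_eq0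
  ?(gt_eqF (alpha_gt0 alpha_free _)) //.
by apply: next_moves => k; rewrite iE.
Qed.

(** Differences of points lie in the span by definition. Conversely, the edge
    from a vertex given by [descending_vertex] to its reflection lies in the
    flag face and is a nonzero multiple of the next simple root. *)
Lemma has_dim_flag m : (m <= n)%N -> has_dim (flag_face m) m.
Proof.
move=> mn; split; first by have [] := is_face_flag m.
pose node (i : 'I_m) := invF pos_inj (widen_ord mn i).
have nodeE i : pos (node i) = i :> nat by rewrite /node f_invF.
have node_inj : injective node.
  by move=> i j ij; apply: val_inj; rewrite /= -!nodeE ij.
pose X := [tuple alpha (node i) | i < m].
have freeX : free X.
  apply/freeP => k sum0 i.
  have : coef (\sum_(i < m) k i *: X`_i) (node i) = 0.
    by rewrite sum0 coef0.
  have coefX j l : coef (k j *: X`_j) (node l) = k j * (j == l)%:R.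
    by rewrite coefZ -tnth_nth tnth_mktuple coef_alpha // (inj_eq node_inj).
  rewrite coef_sum (bigD1 i) //= big1 => [|j ji]; rewrite coefX.
    by rewrite eqxx mulr1 addr0.
  by rewrite (negPf ji) mulr0.
have memX j : (pos j < m)%N -> alpha j \in X.
  move=> jm; apply/tnthP; exists (Ordinal jm); rewrite tnth_mktuple.
  by congr alpha; apply/pos_inj/val_inj; rewrite /= nodeE.
have memU y : flag_face m y -> x - y \in <<X>>%VS.
  move=> [_ fy]; rewrite (coefE alpha_free (x - y)) memv_suml // => j _.
  have [jm|mj] := ltnP (pos j) m; last by rewrite fy // scale0r mem0v.
  by rewrite memvZ // memv_span // memX.
exists <<X>>%VS; split.
- by move: freeX; rewrite /free size_tuple => /eqP.
- move=> y z /memU y_ /memU z_.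
  by have := memvB z_ y_; rewrite opprB addrC addrA subrK.
- move=> V VP; apply/span_subvP => _ /tnthP[i ->]; rewrite tnth_mktuple.
  set k := node i; have km : (pos k < m)%N by rewrite nodeE.
  have [s sE] := descending_vertex (ltnW (ltn_ord (pos k))).
  have s0 j : (m <= pos j)%N -> coef (x - act s x) j = 0.
    move=> mj; apply/eqP; rewrite -[_ == _]negbK sE -leqNgt.
    exact: leq_trans (ltnW km) mj.
  pose a := 2 * dot (alpha k) (act s x) / dot (alpha k) (alpha k).
  have aV : a *: alpha k \in V.
    rewrite -(subKr (act s x) (a *: alpha k)).
    apply: VP; first by split=> [|j mj]; [exact: orbit_polytope|exact: s0].
    rewrite -[_ - _]/(act (k :: s) x).
    split=> [|j mj]; first exact: orbit_polytope.
    rewrite /= (coef_sub_refl alpha_free) s0 //; have /negPf -> : k != j.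
      by apply: contraTneq km => ->; rewrite -leqNgt.
    by rewrite mulr0 addr0.
  have a0 : a != 0.
    rewrite !mulf_neq0 ?pnatr_eq0 // ?invr_eq0
      ?(gt_eqF (alpha_gt0 alpha_free _)) //.
    exact: next_moves.
  by have := memvZ a^-1 aV; rewrite scalerA mulVf // scale1r.
Qed.

(** The group acts on faces, so only faces exposed by a dominant form need be
    considered; these are flag faces, and their index is their dimension. *)
Lemma faces_orbit d : (d < n)%N ->
  faces P d = [set w @` flag_face d | w in coxeter_group alpha].
Proof.
move=> dn; apply/seteqP; split=> [F [faceF dimF]|_ [w + <-]]; last first.
  move=> /coxeter_groupP[s ->]; apply: act_faces.
  by split; [exact: is_face_flag|exact: has_dim_flag (ltnW dn)].
have [_ [c [b cP FE]]] := faceF.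
have [s doms] := dominant_in_orbit hW c.
have [[z sFz] [_ _]] := act_face s faceF.
rewrite FE act_supporting_section in sFz.
(* n is a sentinel, reached exactly when the form is zero *)
pose stop m := (m == n) ||
  [exists j, (pos j == m :> nat) && (dot (alpha j) (act s c) != 0)].
have stop_n : exists m, stop m by exists n; rewrite /stop eqxx.
have [m stop_m min_m] := ex_minnP stop_n.
have mn : (m <= n)%N by apply: min_m; rewrite /stop eqxx.
have cm : first_nonzero (act s c) m.
  split=> j jm.
    apply/eqP; apply: contraTT jm => cj; rewrite -leqNgt min_m //.
    by apply/orP; right; apply/existsP; exists j; rewrite eqxx.
  case/orP: stop_m => [/eqP mE|/existsP[k /andP[/eqP km]]].
    by have := ltn_ord (pos j); rewrite jm mE ltnn.
  by have -> : k = j by apply/pos_inj/val_inj; rewrite /= km jm.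
have sF : act s @` F = flag_face m.
  rewrite FE act_supporting_section; apply: exposed_flag_face => //.
    by move=> y Py; rewrite dot_act_rev cP //; apply: act_polytope.
  by exists z.
have dm : d = m.
  apply: has_dim_uniq (has_dim_flag mn); rewrite -sF.
  exact: has_dim_image (@act_linear _ _ _ s) (actK alpha s) dimF.
exists (act (rev s)); first by apply/coxeter_groupP; exists (rev s).
rewrite dm -sF; apply/seteqP; split=> [_ [_ [y Fy <-] <-]|y Fy].
  by rewrite actK.
by exists (act s y); [exists y|rewrite actK].
Qed.

End LineDiagram.

(** * The diagram numbered from the decorated end *)

Lemma rev_adjacent (m a b : nat) : (a < m)%N -> (b < m)%N ->
  ((a.+1 == b) || (b.+1 == a)) =
  (((m - a.+1).+1 == m - b.+1) || ((m - b.+1).+1 == m - a.+1))%N.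
Proof. lia. Qed.

Theorem proposition2p1 (R : realType) (n : nat) (hn : (3 <= n)%N)
    (alpha : 'I_n -> 'rV[R]_n) (hW : finite_coxeter alpha)
    (x0 : 'rV[R]_n) (hx0 : dominant alpha x0)
    (hline : line_diagram alpha)
    (hseed : exists k : 'I_n,
        end_node alpha k /\ (forall j : 'I_n, square alpha x0 j <-> j = k)) :
  platonic (coxeter_group alpha) (polytope alpha x0).
Proof.
have [s sE] := hline; have [e [e_end e_seed]] := hseed.
have alpha_free := finite_coxeter_free hW.
have seedE j : (dot (alpha j) x0 != 0) = (j == e).
  apply/idP/eqP => [j0|/e_seed].
    apply/e_seed => /(refl_id (alpha_neq0 alpha_free j)) /eqP.
    exact/negP.
  move=> j_sq; apply/eqP => j0; apply: j_sq.
  by rewrite /refl j0 mulr0 mul0r scale0r subr0.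
suff [pos [pos_inj linkE pos_e]] : exists pos : 'I_n -> 'I_n,
  [/\ injective pos,
      forall i j,
        linked alpha i j = ((pos i).+1 == pos j) || ((pos j).+1 == pos i) &
      pos e = 0%N :> nat].
  move=> d dn; exists (flag_face alpha x0 pos d).
  apply: faces_orbit => // j; rewrite seedE -pos_e.
  by apply/eqP/eqP => [->//|/val_inj/pos_inj].
have linkE i j : linked alpha i j =
    (((s^-1)%g i).+1 == (s^-1)%g j :> nat) ||
    (((s^-1)%g j).+1 == (s^-1)%g i :> nat).
  by rewrite -sE !permKV.
(* If e is not already first, it is last and the numbering is reversed: an
   interior node would have two neighbours. *)
pose p := (s^-1)%g e.
have [p0|p0] := eqVneq (p : nat) 0%N.
  by exists (s^-1)%g; split=> //; apply: perm_inj.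
have [pn|pn] := eqVneq p.+1 n.
  exists (fun i => rev_ord ((s^-1)%g i)).
  split=> [i j /rev_ord_inj/perm_inj//|i j|] /=.
    by rewrite linkE (rev_adjacent (ltn_ord _) (ltn_ord _)).
  by rewrite -/p pn subnn.
have p_lt : (p.-1 < n)%N by apply: leq_ltn_trans (leq_pred _) (ltn_ord _).
have p_gt : (p.+1 < n)%N by rewrite ltn_neqAle pn ltn_ord.
have /eqP/cards1P[a aE] := e_end.
have nbr_a (j : 'I_n) : (p.+1 == j :> nat) || (j.+1 == p :> nat) -> s j = a.
  by move=> pj; apply/set1P; rewrite -aE inE linkE permK.
have lt_a : s (Ordinal p_lt) = a.
  by apply: nbr_a; rewrite /= prednK ?lt0n // eqxx orbT.
have gt_a : s (Ordinal p_gt) = a by apply: nbr_a; rewrite /= eqxx.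
have : p.-1 = p.+1 by have /perm_inj[] := etrans lt_a (esym gt_a).
by have := leq_pred p; rewrite -ltnS => /[swap] ->; rewrite ltnn.
Qed.
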